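(* Let $(f,q)$, with $f=(f_1,\dots,f_m)^T$ and $q=(q_1,\dots,q_m)^T$, be the (continuous, i.e. non-discretized) solution of the coupled PDE-ODE production system $$\partial_t f(t,x)+\Lambda\,\partial_x f(t,x)=0,\quad x\in[0,l],\ t\in\mathbb{R}_+,\qquad \partial_t q(t)=g_{in}(t)-g_{out}(t),$$ with $\Lambda=\mathrm{diag}(v_1,\dots,v_m)$, $v_e>0$, and with $g_{in},g_{out}$ and initial values as described in the context. Let $\eta,\tilde\eta>0$ and $p_e,c_e>0$ for $e\in\{1,\dots,m\}$, and set $$P(x)=\mathrm{diag}\big(p_1e^{-\eta x},\dots,p_me^{-\eta x}\big),\qquad Q(t)=\mathrm{diag}\big(c_1e^{-\tilde\eta v_1t},\dots,c_me^{-\tilde\eta v_mt}\big),$$ $$V(t)=\int_0^l f(t,x)^TP(x)f(t,x)\,dx+q(t)^TQ(t)q(t).$$ Then the continuous solution satisfies $$\dot V\le-\nu V,$$ i.e. exponential decay of $V$ is obtained, if $$-f(t,l)^T\Lambda P(l)f(t,l)+f(t,0)^T\Lambda P(0)f(t,0)+2\,\partial_tq(t)^TQ(t)q(t)\le 0$$ is fulfilled for all $t\in\mathbb{R}_+$. The decay rate $\nu$ is given by $$\nu=\min(\eta,\tilde\eta)\,\min_{e}(v_e)>0.$$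
   Context: The model is a serial production system with $m$ processors, each of length $l>0$, with constant velocities $v_e>0$ and constant maximal capacities $\mu_e>0$, and a queue in front of each processor. Here $f_e(t,x)$ is the flux in processor $e$ and $q_e(t)$ is the load of the queue in front of processor $e$. The initial values are $f_e(0,x)=f_{e,0}(x)=v_e\rho_{e,0}(x)$, where $\rho_{e,0}$ is the initial product density in processor $e$ (with $v_e\rho_{e,0}\le\mu_e$, under which the model dynamics reduces to the linear advection equation), and $q(0)=q_0\ge0$. The inflow into queue $e$ is $g_{in,e}(t)=f_{e-1}(t,l)$ for $e=2,\dots,m$, while $g_{in,1}(t)$ is an externally given inflow (or control input). The outflow from queue $e$ into processor $e$ is $g_{out,e}(t)=f_e(t,0)$, with the coupling condition $$g_{out,e}(t)=\begin{cases}\min\{g_{in,e}(t),\mu_e\},& q_e(t)=0,\\ \mu_e,& q_e(t)>0,\end{cases}$$ which may be approximated by the smoothed version $g_{out,e}(t)\approx\min\{\mu_e,\,q_e(t)/\epsilon\}$ with $\epsilon\ll1$. The vectors are $g_{in}=(g_{in,1},\dots,g_{in,m})^T$ and $g_{out}=(g_{out,1},\dots,g_{out,m})^T$. $\dot V$ denotes the time derivative of $V$ along the solution. *)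

(* Defs.v *)
From mathcomp Require Import all_boot all_order all_algebra.
From mathcomp Require Import all_classical all_reals all_analysis.

Set Implicit Arguments.
Unset Strict Implicit.
Unset Printing Implicit Defensive.

Import Order.TTheory GRing.Theory Num.Theory.
Import numFieldNormedType.Exports.

Local Open Scope classical_set_scope.
Local Open Scope ring_scope.

(* The line has n.+1 processors, indexed from 0 by 'I_n.+1, so it is never    *)
(* empty and the minimum over the processors makes sense.                     *)
(*                                                                            *)
(* Both coupling conditions produce kinks and jumps: when a queue runs empty, *)
(* its outflow drops from mu_e to min(g_in,e, mu_e), the load has a corner,   *)
(* and the jump of the flux is carried along the characteristic               *)
(* t - x / v_e = const. Solutions are therefore classical off exceptional     *)
(* characteristics, namely those whose label t - x / v_e lies in a countable  *)
(* set E. Labels in E that are negative come from the initial data, and 0 is  *)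
(* the label of the corner (t, x) = (0, 0). For E = set0 the solution is      *)
(* classical everywhere.                                                      *)

Section Model.
Context {R : realType} {n : nat}.
Implicit Types (f : R -> R -> 'cV[R]_n.+1) (q : R -> 'cV[R]_n.+1).
Implicit Types (l : R) (u : R -> R) (v mu p c : 'I_n.+1 -> R) (E : set R).

Definition inflow l u f (t : R) : 'cV[R]_n.+1 :=
  \col_e (if e == ord0 then u t else f t l (inord e.-1) 0).

Definition outflow f (t : R) : 'cV[R]_n.+1 := f t 0.

(* No alternative covers qe < 0: this coupling keeps the queues nonnegative.  *)
Definition exact_coupling (mue qe gin gout : R) : Prop :=
  (qe = 0 /\ gout = Num.min gin mue) \/ (0 < qe /\ gout = mue).

Definition smoothed_coupling (eps mue qe gout : R) : Prop :=
  gout = Num.min mue (qe / eps).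

(* No exceptional characteristic meets a boundary x = 0 or x = l at time t.   *)
Definition regular_time l v E (t : R) : Prop :=
  0 < t /\ forall e, ~ E t /\ ~ E (t - l / v e).

Definition regular_domain l v E (e : 'I_n.+1) : set (R * R) :=
  [set z | [/\ 0 <= z.1, 0 <= z.2 <= l & ~ E (z.1 - z.2 / v e)]].

Record is_solution l v mu u (rho0 : R -> 'cV[R]_n.+1) (q0 : 'cV[R]_n.+1)
    E f q : Prop := IsSolution {
  flux_locally_bounded : forall T : R, exists M : R,
    forall t x e, 0 <= t <= T -> 0 <= x <= l -> `|f t x e 0| <= M;
  flux_continuous : forall e,
    {within regular_domain l v E e, continuous (fun z : R * R => f z.1 z.2 e 0)};
  flux_differentiable : forall e t x, 0 < t -> 0 < x < l -> ~ E (t - x / v e) ->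
    differentiable (fun z : R * R => f z.1 z.2 e 0) (t, x);
  transport : forall e t x, 0 < t -> 0 < x < l -> ~ E (t - x / v e) ->
    (fun s => f s x e 0)^`()%classic t + v e * (fun y => f t y e 0)^`()%classic x = 0;
  (* the value at the corner (0, 0) is the outflow of the queue *)
  flux_init : forall e x, 0 < x <= l -> f 0 x e 0 = v e * rho0 x e 0;
  flux_init_capacity : forall e x, 0 < x <= l -> v e * rho0 x e 0 <= mu e;
  load_continuous : {within [set t | 0 <= t], continuous q};
  load_derivable : forall t, regular_time l v E t -> derivable q t 1;
  load_balance : forall t, regular_time l v E t ->
    q^`()%classic t = inflow l u f t - outflow f t;
  load_init : q 0 = q0;
  load_init_ge0 : forall e, 0 <= q0 e 0;
  coupling :
    (forall t e, 0 <= t ->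
      exact_coupling (mu e) (q t e 0) (inflow l u f t e 0) (outflow f t e 0))
    \/ (exists2 eps : R, 0 < eps & forall t e, 0 <= t ->
      smoothed_coupling eps (mu e) (q t e 0) (outflow f t e 0))
}.

Definition Lambda v : 'M[R]_n.+1 := diag_mx (\row_e v e).

Definition weightP (eta : R) p (x : R) : 'M[R]_n.+1 :=
  diag_mx (\row_e (p e * expR (- eta * x))).

Definition weightQ (etaq : R) v c (t : R) : 'M[R]_n.+1 :=
  diag_mx (\row_e (c e * expR (- etaq * v e * t))).

(* The entry (0, 0) turns a 1 x 1 matrix into a scalar.                       *)
Definition lyapunov l v eta p etaq c f q (t : R) : R :=
  \int[lebesgue_measure]_(x in `[0, l])
    ((f t x)^T *m weightP eta p x *m f t x) 0 0
  + ((q t)^T *m weightQ etaq v c t *m q t) 0 0.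

Definition boundary_form l v eta p etaq c f q (t : R) : R :=
  - ((f t l)^T *m Lambda v *m weightP eta p l *m f t l) 0 0
  + ((f t 0)^T *m Lambda v *m weightP eta p 0 *m f t 0) 0 0
  + 2 * ((q^`()%classic t)^T *m weightQ etaq v c t *m q t) 0 0.

Definition decay_rate v (eta etaq : R) : R :=
  Num.min eta etaq * \big[Num.min/v ord0]_e v e.

End Model.

(* Main.v *)
Require Import Defs.
From mathcomp Require Import all_boot all_order all_algebra.
From mathcomp Require Import all_classical all_reals all_analysis.
From mathcomp Require Import measurable_realfun ring lra.
Import Order.TTheory GRing.Theory Num.Theory.
Import numFieldNormedType.Exports.
Local Open Scope classical_set_scope.
Local Open Scope ring_scope.

Set Implicit Arguments.
Unset Strict Implicit.
Unset Printing Implicit Defensive.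

(* Off the exceptional characteristics each flux is a function psi of          *)
(* x - v t, so after a translation its weighted energy on [0, l] is            *)
(* exp (- eta v t) times the integral of exp (- eta y) psi(y)^2 between        *)
(* - v t and l - v t. The integrand is continuous off a countable set, so the  *)
(* fundamental theorem of calculus differentiates the energy without any       *)
(* integration by parts, and its boundary terms make up the boundary form.     *)
(* Hence V' <= - nu V at regular times; as V is continuous and only countably  *)
(* many times are not regular, exp (nu t) V(t) is nonincreasing.               *)

(** For one processor the substitution y = x - v t turns the weighted energy into exp(- eta v t)
    times a difference of values of a fixed primitive, at l - v t and at - v t ([energyE]).
    Differentiating the exponential gives the damping - eta v times the energy; the two moving
    endpoints give the outgoing term at x = l and the incoming term at x = 0 ([is_derive_energy]).
    In the same way, the weight of each queue gives - etaq v_e times its part of V. What is left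
    over after summation is exactly the boundary form ([is_derive_lyapunov]); dropping it, and
    bounding every damping factor below by nu ([decay_rate_le]), gives V' <= - nu V.

    This inequality is only known at regular times. Integrating it takes two more facts: V is
    continuous at all times, regular or not ([lyapunov_continuous]), and a continuous function whose
    derivative is nonpositive off a countable set is nonincreasing
    ([le0_derive1_nincr_countable]). *)

Lemma uncountable_itv (R : realType) (a b : R) : a < b -> ~ countable `]a, b[%classic.
Proof.
move=> ab /countable_lebesgue_measure0.
rewrite lebesgue_measure_itv/= lte_fin ab -EFinD => /eqP.
by rewrite eqe subr_eq0 gt_eqF.
Qed.

(* Zygmund's argument: pick a value y between g a and g b that g does not take *)
(* on C; the last point where g <= y is then outside C, and g' >= 0 there.     *)
Lemma lt0_derive1_nincr_countable (R : realType) (g : R -> R) (C : set R) (a b : R) :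
  countable C -> a <= b -> {within `[a, b], continuous g} ->
  (forall x, a < x < b -> ~ C x -> derivable g x 1 /\ g^`()%classic x < 0) ->
  g b <= g a.
Proof.
move=> cC ab cg dg; rewrite leNgt; apply/negP => gab.
have {}ab : a < b.
  by rewrite lt_neqAle ab andbT; apply: contraTneq gab => ->; rewrite ltxx.
(* Otherwise the countable image of C would contain the whole interval between g a and g b. *)
have [y /= yab gCy] : exists2 y, g a < y < g b & ~ (g @` C) y.
  apply/not_exists2P => H; apply: (uncountable_itv gab).
  apply: (@sub_countable _ _ _ (g @` C)); last exact: card_le_trans (card_image_le _ _) cC.
  apply: subset_card_le => y; rewrite /= in_itv/= => yab.
  by have [|/contrapT] := H y.
case/andP: yab => gay ygb.
pose S := [set t | a <= t <= b /\ g t <= y].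
have Sa : S a by split; rewrite ?lexx ?ltW.
have Sb : ubound S b by move=> t [/andP[]].
have hS : has_sup S by split; [exists a | exists b].
set x := sup S.
have ax : a <= x by apply: ub_le_sup => //; exists b.
have xb : x <= b by apply: ge_sup => //; exists a.
have xab : `[a, b]%classic x by rewrite /= in_itv/= ax xb.
have cgx : g z @[z --> within `[a, b]%classic (nbhs x)] --> g x.
  by move/subspace_continuousP : cg => /(_ _ xab).
have gxy : g x <= y.
  rewrite leNgt; apply/negP => ygx.
  have /cgx : nbhs (g x) [set z | y < z] by exact: lt_nbhsr.
  rewrite /= => -[e /= e0] He.
  have [t St xet] := sup_adherent e0 hS.
  have [/andP[at_ tb] gty] := St.
  have tx : t <= x by apply: ub_le_sup => //; exists b.
  have /= := He t; rewrite ger0_norm ?subr_ge0// ltrBlDr -ltrBlDl.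
  move=> /(_ xet); rewrite in_itv/= at_ tb => /(_ isT).
  by rewrite ltNge gty.
have ltxb : x < b.
  by rewrite lt_neqAle xb andbT; apply: contraTneq ygb => <-; rewrite -leNgt.
have gt_y t : x < t <= b -> y < g t.
  move=> /andP[xt tb]; rewrite ltNge; apply/negP => gty.
  suff : t <= x by rewrite leNgt xt.
  by apply: ub_le_sup; [exists b|split=> //; rewrite tb andbT (le_trans ax)// ltW].
have {}gxy : g x = y.
  apply/eqP; rewrite eq_le gxy /= leNgt; apply/negP => gx_lt.
  have /cgx : nbhs (g x) [set z | z < y] by exact: lt_nbhsl.
  rewrite /= => -[e /= e0] He.
  pose t := Num.min b (x + e / 2).
  have xt : x < t by rewrite lt_min ltxb ltrDl divr_gt0.
  have tb : t <= b by rewrite ge_min lexx.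
  have te : t - x < e.
    rewrite ltrBlDl (@le_lt_trans _ _ (x + e / 2))// ?ge_min ?lexx ?orbT//.
    by rewrite ltrD2l ltr_pdivrMr// ltr_pMr// ltr1n.
  have /= := He t; rewrite distrC gtr0_norm ?subr_gt0// in_itv/= tb.
  rewrite (le_trans ax (ltW xt)) => /(_ te isT).
  by apply/negP; rewrite -leNgt ltW// gt_y// xt.
have ltax : a < x.
  by rewrite lt_neqAle ax andbT; apply: contraTneq gay => ->; rewrite gxy ltxx.
have [|Cx|dgx] := dg x; first by rewrite ltax.
  by apply: gCy; exists x.
(* A negative derivative makes the right difference quotients at x negative, but g exceeds y = g x
   on ]x, b]. The increment h below lies in the neighbourhood and keeps x + h <= b. *)
move=> g'x0.
have : \forall h \near 0^', h^-1 *: (g (h *: 1 + x) - g x) < 0.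
  by apply: (cvgr_lt _ dgx); move: g'x0; rewrite derive1E.
move=> [e /= e0] He.
pose h := Num.min (e / 2) (b - x).
have h0 : 0 < h by rewrite lt_min divr_gt0//= subr_gt0.
have he : h < e.
  by rewrite (@le_lt_trans _ _ (e / 2))// ?ge_min ?lexx// ltr_pdivrMr// ltr_pMr// ltr1n.
have := He h; rewrite /= sub0r normrN gtr0_norm// => /(_ he).
rewrite gt_eqF// => /(_ isT); apply/negP; rewrite -leNgt mulr_ge0 ?invr_ge0 ?ltW//.
rewrite subr_gt0 gxy gt_y// [h *: 1]mulr1 ltrDr h0/=.
by rewrite -lerBrDr ge_min lexx orbT.
Qed.

(** Subtracting d x with a small slope d > 0 makes the derivative strictly negative; the error d (b
    - a) is arbitrarily small. *)
Lemma le0_derive1_nincr_countable (R : realType) (g : R -> R) (C : set R) (a b : R) :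
  countable C -> a <= b -> {within `[a, b], continuous g} ->
  (forall x, a < x < b -> ~ C x -> derivable g x 1 /\ g^`()%classic x <= 0) ->
  g b <= g a.
Proof.
move=> cC ab cg dg; apply/ler_addgt0Pr => e e0.
(* The slope satisfies d (b - a) <= e; the added 1 keeps the denominator positive when a = b. *)
pose d := e / (b - a + 1).
have ba1 : 0 < b - a + 1 by rewrite ltr_wpDl ?subr_ge0.
have d0 : 0 < d by rewrite divr_gt0.
have : g b - d * b <= g a - d * a.
  apply: (@lt0_derive1_nincr_countable _ (fun x => g x - d * x) C) => //.
    move=> x; apply: continuousB; first exact: cg.
    by apply: continuous_subspaceT => {}x; exact: mulrl_continuous.
  move=> x xab /dg-/(_ xab)[dgx g'x].
  have dl : is_derive x 1 (fun x => d * x) d.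
    have := @is_deriveZ _ _ _ (id : R -> R) d x 1 1 (is_derive_id _ _).
    by rewrite [d *: 1]mulr1.
  have dg' : is_derive x 1 g (g^`()%classic x).
    by rewrite derive1E; exact: derivableP.
  have [D1 D2] := is_deriveB dg' dl.
  split; first exact: D1.
  by rewrite derive1E D2 subr_lt0 (le_lt_trans g'x).
move=> H; have -> : g b = g b - d * b + d * b by rewrite subrK.
rewrite (le_trans (lerD H (lexx _)))// -addrA lerD2l addrC -mulrBr.
by rewrite /d mulrAC ler_pdivrMr// ler_pM2l// lerDl.
Qed.

(** * Lebesgue integration modulo countable sets *)

Section lebesgue.
Context {R : realType}.
Local Notation mu := (@lebesgue_measure R).
Implicit Types (f : R -> R) (N : set R).

Lemma measurable_countable N : countable N -> measurable (N : set (measurableTypeR R)).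
Proof. by apply: countable_measurable => t; exact: measurable_set1. Qed.

(** Every subset of a countable set is measurable, so any function is measurable on the part of D
    inside N. *)
Lemma measurable_fun_countableD N f (D : set R) : countable N -> measurable D ->
  measurable_fun (D `\` N) f -> measurable_fun D f.
Proof.
move=> cN mD mf; have mN := measurable_countable cN.
rewrite (_ : D = (D `&` N) `|` (D `\` N)); last by rewrite setUIDK.
apply/measurable_funU; [exact: measurableI|exact: measurableD|split=> //].
move=> _ Y mY; apply: measurable_countable.
by apply: sub_countable cN; apply: subset_card_le => x [[]].
Qed.

Lemma ae_countableC N (P : R -> Prop) : countable N -> (forall x, ~ N x -> P x) ->
  {ae mu, forall x, P x}.
Proof.
move=> cN NP; exists N; split; first exact: measurable_countable.
  exact: countable_lebesgue_measure0.
by move=> x /= nP; apply: contrapT => /NP.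
Qed.

Lemma eq_Rintegral_countable N f g (D : set R) : countable N ->
  measurable D -> measurable_fun D f -> measurable_fun D g ->
  (forall x, D x -> ~ N x -> f x = g x) ->
  \int[mu]_(x in D) f x = \int[mu]_(x in D) g x.
Proof.
move=> cN mD mf mg fg; rewrite /Rintegral; congr fine.
apply: ae_eq_integral => //; [exact/measurable_EFinP..|].
by apply: (ae_countableC cN) => x nNx Dx; rewrite /= fg.
Qed.

(** The pushforward of Lebesgue measure under translation agrees with Lebesgue measure on half-open
    intervals, hence everywhere by uniqueness. *)
Lemma Rintegral_translate f (a b c : R) : measurable_fun setT f ->
  (forall x, 0 <= f x) ->
  \int[mu]_(x in `[a, b]) f (x + c) = \int[mu]_(x in `[a + c, b + c]) f x.
Proof.
move=> mf f0; rewrite /Rintegral; congr fine.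
pose phi (x : measurableTypeR R) : measurableTypeR R := x + c.
have mphi : measurable_fun setT phi by exact: measurable_funD.
(* The booleans cover both the half-open intervals of the uniqueness argument and the closed domain
   of integration. *)
have pre (i j : bool) (p q : R) : phi @^-1` [set` Interval (BSide i (p + c)) (BSide j (q + c))] =
    [set` Interval (BSide i p) (BSide j q)].
  apply/seteqP; split=> x /=; rewrite /phi !in_itv/=;
  by case: i; case: j; rewrite /= ?lerD2r ?ltrD2r.
pose D : set R := `[a + c, b + c]%classic.
transitivity (\int[pushforward mu phi]_(x in D) (f x)%:E)%E; last first.
  apply: eq_measure_integral => A mA _; apply/esym.
  apply: (lebesgue_measure_unique (mu := pushforward mu phi)) => // X /ocitvP[->|[[p q]/= pq ->]].
    by rewrite !measure0.
  rewrite /pushforward -(subrK c p) -(subrK c q) pre !lebesgue_measure_itv/= !lte_fin ltrD2r.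
  by case: ifP => // _; rewrite -!EFinD; congr EFin; lra.
rewrite ge0_integral_pushforward//=.
  by rewrite pre.
- exact: (measurable_itv `[a + c, b + c]%R).
- by apply/measurable_EFinP; exact: measurable_funTS.
- by move=> y _; rewrite lee_fin.
Qed.

(** A fundamental theorem of calculus for integrands with countably many jumps: the jumps may
    accumulate at x, so continuity at x is only asked along the complement of N. *)
Lemma is_derive_Rintegral_countable f N (a x u : R) : countable N ->
  measurable_fun setT f -> a < x < u -> mu.-integrable `[a, u] (EFin \o f) ->
  f y @[y --> within (~` N) (nbhs x)] --> f x ->
  is_derive x 1 (fun y => \int[mu]_(t in `[a, y]) f t) (f x).
Proof.
move=> cN mf /andP[ax xu] intf fx.
have mN : measurable (N : set (measurableTypeR R)) by exact: measurable_countable.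
(* Changing f on N does not affect the integral and makes it continuous at x. *)
pose g y := if y \in N then f x else f y.
have mg : measurable_fun setT g.
  apply: (measurable_fun_countableD cN) => //.
  apply: (eq_measurable_fun f); last exact: measurable_funTS.
  by move=> y; rewrite inE => -[_ Ny]; rewrite /= /g memNset.
have intg : mu.-integrable `[a, u] (EFin \o g).
  apply/(negligible_integrable mN); rewrite ?countable_lebesgue_measure0//.
    by apply/measurable_EFinP; exact: measurable_funTS.
    exact: countable_lebesgue_measure0.
  have : mu.-integrable (`[a, u] `\` N) (EFin \o f).
    by apply: integrableS intf => //; exact: measurableD.
  apply: eq_integrable; first exact: measurableD.
  by move=> y; rewrite inE => -[_ Ny]; rewrite /= /g memNset.
have gx : {for x, continuous g}.
  have gxE : g x = f x by rewrite /g; case: ifP.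
  apply/cvgrPdist_lt => e e0; rewrite gxE.
  move/cvgrPdist_lt : fx => /(_ _ e0); rewrite near_withinE.
  apply: filterS => y Hy; rewrite /g.
  case: ifPn => [_|]; first by rewrite subrr normr0.
  by rewrite notin_setE => /Hy.
have [] := @continuous_FTC1 R g (BLeft a) x u xu intg _ gx; first by rewrite lte_fin.
rewrite (_ : (fun x0 => _) = (fun y => \int[mu]_(t in `[a, y]) f t)); last first.
  apply/funext => y; apply: (@eq_Rintegral_countable N) => //.
  - exact: measurable_funTS.
  - exact: measurable_funTS.
  - by move=> z _ Nz; rewrite /= /g memNset.
move=> dF F'; have -> : f x = g x by rewrite /g; case: ifP.
by rewrite -F' derive1E; exact: derivableP.
Qed.

End lebesgue.

(** * Continuity and derivatives of elementary maps *)

Lemma within_continuous_precomp (T U V : topologicalType) (A : set T) (B : set U)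
    (h : T -> U) (f : U -> V) :
  (forall x, A x -> B (h x)) -> continuous h -> {within B, continuous f} ->
  {within A, continuous (f \o h)}.
Proof.
move=> hAB ch /subspace_continuousP cf; apply/subspace_continuousP => x Ax P fP.
have : nbhs (h x) [set y | B y -> P (f y)] by exact: (cf _ (hAB _ Ax)).
move/(ch x) => fhP.
have {}fhP : nbhs x [set y | B (h y) -> P (f (h y))] by [].
have sub : [set y | B (h y) -> P (f (h y))] `<=` [set y | A y -> P (f (h y))].
  by move=> y /= + /hAB.
exact: (filterS sub fhP).
Qed.

Lemma continuous_pair (T U V : topologicalType) (g : T -> U) (h : T -> V) :
  continuous g -> continuous h -> continuous (fun x => (g x, h x)).
Proof. by move=> cg ch x; exact: (cvg_pair (cg x) (ch x)). Qed.

Lemma continuous_affine (R : realType) (a b : R) : continuous (fun x => a + b * x).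
Proof.
by move=> x; apply: cvgD; [exact: cvg_cst|exact: mulrl_continuous].
Qed.

Lemma is_derive_affine (R : realType) (a b x : R) :
  is_derive x 1 (fun y : R => a + b * y) b.
Proof.
have dl : is_derive x 1 (fun y : R => b * y) b.
  have := @is_deriveZ _ _ _ (id : R -> R) b x 1 1 (is_derive_id _ _).
  by rewrite [b *: 1]mulr1.
by have := is_deriveD (is_derive_cst a x 1) dl; rewrite add0r.
Qed.

Lemma is_derive_expR_linear (R : realType) (b x : R) :
  is_derive x 1 (fun y : R => expR (b * y)) (b * expR (b * x)).
Proof.
rewrite mulrC -[b * x]add0r.
have <- : expR \o (fun y => 0 + b * y) = (fun y => expR (b * y)).
  by apply/funext => y; rewrite /= add0r.
exact: is_derive1_comp (is_derive_expR _) (is_derive_affine _ _ _).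
Qed.

(** * Energy of a single processor along its characteristics *)

Definition energy (R : realType) (eta l : R) (F : R -> R -> R) (t : R) : R :=
  \int[lebesgue_measure]_(x in `[0, l]) (expR (- eta * x) * F t x ^+ 2).

Section characteristics.
Context {R : realType}.

(** Expresses both partial derivatives and the derivative along a characteristic as values of one
    differential, so that linearity relates them. *)
Lemma derivable_line (f : R * R -> R) (z w : R * R) (g : R -> R) (s : R) :
  (forall h, g (h + s) = f (h *: w + z)) -> differentiable f z ->
  derivable g s 1 /\ g^`()%classic s = 'd f z w.
Proof.
move=> gE df; have fgE : (fun h : R => h^-1 *: (f (h *: w + z) - f z)) =
    (fun h : R => h^-1 *: (g (h *: 1 + s) - g s)).
  apply/funext => h; rewrite gE [h *: 1]mulr1; congr (_ *: (_ - _)).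
  by have := gE 0; rewrite add0r scale0r add0r.
have := @diff_derivable _ _ _ _ _ w df.
rewrite derive1E -deriveE// /derivable /derive fgE; split => //.
Qed.

Context (F : R -> R -> R) (l v : R) (E : set R).
Hypotheses (l_gt0 : 0 < l) (v_gt0 : 0 < v) (E_countable : countable E).
Local Notation f := (fun z : R * R => F z.1 z.2).
Local Notation dom :=
  [set z : R * R | [/\ 0 <= z.1, 0 <= z.2 <= l & ~ E (z.1 - z.2 / v)]].
Hypothesis F_continuous : {within dom, continuous f}.
Hypothesis F_differentiable : forall t x : R, 0 < t -> 0 < x < l -> ~ E (t - x / v) ->
  differentiable f (t, x).
Hypothesis F_transport : forall t x : R, 0 < t -> 0 < x < l -> ~ E (t - x / v) ->
  (F^~ x)^`()%classic t + v * (F t)^`()%classic x = 0.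
Hypothesis F_bounded : forall T : R, exists M : R,
  forall t x : R, 0 <= t <= T -> 0 <= x <= l -> `|F t x| <= M.

(** The direction (1, v) is (1, 0) + v (0, 1), so the derivative is the left side of the transport
    equation; the label t - x / v does not change along the line. *)
Lemma derive_characteristic (t x s : R) : 0 < t + s -> 0 < x + v * s < l ->
  ~ E (t - x / v) ->
  let g r := F (t + r) (x + v * r) in derivable g s 1 /\ g^`()%classic s = 0.
Proof.
move=> ts xs nE g; set z := (t + s, x + v * s).
have nE' : ~ E (t + s - (x + v * s) / v).
  by rewrite (_ : _ - _ = t - x / v)//; field; rewrite gt_eqF.
have df : differentiable f z by exact: F_differentiable.
have [] := @derivable_line f z (1, v) g s _ df.
  by move=> h; rewrite /g /z /= /GRing.scale /= mulr1; congr F; ring.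
move=> dg ->; split => //.
have [_ d1] := @derivable_line f z (1, 0) (F^~ (x + v * s)) (t + s)
  (fun h => ltac:(by rewrite /z /= /GRing.scale /= mulr1 mulr0 add0r)) df.
have [_ d2] := @derivable_line f z (0, 1) (F (t + s)) (x + v * s)
  (fun h => ltac:(by rewrite /z /= /GRing.scale /= mulr1 mulr0 add0r)) df.
rewrite -(F_transport ts xs nE') d1 d2.
rewrite (_ : (1, v) = (1, 0) + v *: (0, 1)); last first.
  by congr pair; rewrite /= /GRing.scale /= ?mulr0 ?mulr1 ?addr0 ?add0r.
by rewrite linearD linearZ.
Qed.

(** The derivative vanishes at interior points, and F is continuous up to the boundary along a
    non-exceptional characteristic, so the endpoints may lie on t = 0, x = 0 or x = l. *)
Lemma constant_characteristic (t x s : R) : 0 <= t -> 0 <= x -> 0 <= s ->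
  x + v * s <= l -> ~ E (t - x / v) -> F (t + s) (x + v * s) = F t x.
Proof.
move=> t0 x0 s0 xsl nE; pose g r := F (t + r) (x + v * r).
have vs r : 0 <= r -> 0 <= v * r by move=> r0; rewrite mulr_ge0// ltW.
have cg : {within `[0, s], continuous g}.
  apply: (@within_continuous_precomp _ _ _ _ dom (fun r => (t + r, x + v * r)) f) => //.
    move=> r /=; rewrite in_itv/= => /andP[r0 rs]; split => /=.
    - by rewrite addr_ge0.
    - by rewrite addr_ge0 ?vs//= (le_trans _ xsl)// lerD2l ler_pM2l.
    - by rewrite (_ : _ - _ = t - x / v)//; field; rewrite gt_eqF.
  apply: continuous_pair; last exact: continuous_affine.
  by move=> r; apply: cvgD; [exact: cvg_cst|exact: cvg_id].
have dg r : r \in `]0, s[ -> derivable g r 1 /\ g^`()%classic r = 0.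
  rewrite in_itv/= => /andP[r0 rs]; apply: derive_characteristic => //.
    by rewrite ltr_wpDl.
  rewrite ltr_wpDl ?mulr_gt0//= (lt_le_trans _ xsl)// ltrD2l ltr_pM2l//.
have g0s : g s = g 0.
  have s_in : s \in `[0, s] by rewrite in_itv/= s0 lexx.
  have o_in : 0 \in `[0, s] by rewrite in_itv/= s0 lexx.
  apply/eqP; rewrite eq_le; apply/andP; split.
    apply: (ler0_derive1_le_cc _ _ cg s_in o_in s0) => r /dg[]// _ ->.
    exact: lexx.
  apply: (ger0_derive1_le_cc _ _ cg o_in s_in s0) => r /dg[]// _ ->.
  exact: lexx.
by move: g0s; rewrite /g mulr0 !addr0.
Qed.

(** The exceptional characteristics indexed by y = x - v t instead of by their label, which is t - x
    / v = - y / v. *)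
Let N : set R := [set y | E (- y / v)].

(* The value of F on the characteristic with foot y = x - v t, traced back to   *)
(* the boundary x = 0 or to t = 0; it is 0 where no characteristic enters the  *)
(* strip.                                                                      *)
Let psi (y : R) : R := if y <= 0 then F (- y / v) 0 else if y <= l then F 0 y else 0.

Let v_neq0 : v != 0. Proof. by rewrite gt_eqF. Qed.

Let N_countable : countable N.
Proof.
apply: (@sub_countable _ _ _ ((fun e => - (v * e)) @` E)).
  apply: subset_card_le => y Ey; exists (- y / v) => //=.
  by field.
exact: card_le_trans (card_image_le _ _) E_countable.
Qed.

(** If x <= v t, the characteristic entered through x = 0 at time t - x / v; otherwise it started at
    time 0 from the point x - v t. *)
Let psiE (t x : R) : 0 <= t -> 0 <= x <= l -> ~ E (t - x / v) -> F t x = psi (x - v * t).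
Proof.
move=> t0 /andP[x0 xl] nE; rewrite /psi; case: ifPn => [xvt|].
  have E1 : - (x - v * t) / v = t - x / v by field.
  have E2 : F (- (x - v * t) / v + x / v) (0 + v * (x / v)) = F (- (x - v * t) / v) 0.
    apply: constant_characteristic => //.
    - by rewrite divr_ge0 ?oppr_ge0// ltW.
    - by rewrite divr_ge0// ltW.
    - by rewrite add0r mulrC divfK.
    - by rewrite mul0r subr0 E1.
  by rewrite -E2 E1 subrK add0r mulrC divfK.
rewrite -ltNge => xvt; rewrite (le_trans _ xl) ?gerBl ?mulr_ge0 ?(ltW v_gt0)//.
have <- : F (0 + t) (x - v * t + v * t) = F 0 (x - v * t).
  apply: constant_characteristic => //; [exact: ltW|by rewrite subrK|].
  by rewrite (_ : 0 - _ = t - x / v)//; field.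
by rewrite add0r subrK.
Qed.

Let psi_bounded (T : R) : exists2 M : R, 0 <= M & forall y : R, - (v * T) <= y -> `|psi y| <= M.
Proof.
(* The maximum keeps time 0 in range even for negative T, which yields 0 <= M and bounds the initial
   data. *)
have [M FM] := F_bounded (Num.max 0 T).
have T0 : 0 <= Num.max 0 T by rewrite le_max lexx.
have M0 : 0 <= M.
  by apply: le_trans (FM 0 0 _ _); rewrite ?normr_ge0 ?lexx//= ltW.
exists M => // y Ty; rewrite /psi; case: ifPn => [y0|]; last rewrite -ltNge => y0.
  apply: FM; last by rewrite lexx ltW.
  rewrite divr_ge0 ?oppr_ge0 ?(ltW v_gt0)//= le_max; apply/orP; right.
  by rewrite ler_pdivrMr// mulrC lerNl.
by case: ifPn => yl; [apply: FM; rewrite ?lexx// (ltW y0) | rewrite normr0].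
Qed.

(** At y = 0 the formula for [psi] switches from boundary to initial data; nearby characteristics of
    both kinds are compared at one interior time t0. *)
Let psi_cvg (y : R) : y < l -> ~ N y -> psi z @[z --> within (~` N) (nbhs y)] --> psi y.
Proof.
(* The midpoint of [Num.max 0 y] and l is interior and lies beyond y, so that t0 > 0. *)
move=> yl Ny; pose x0 := (Num.max 0 y + l) / 2; pose t0 := (x0 - y) / v.
have m0 : 0 <= Num.max 0 y by rewrite le_max lexx.
have my : y <= Num.max 0 y by rewrite le_max lexx orbT.
have ml : Num.max 0 y < l by rewrite gt_max l_gt0.
have x0_gt0 : 0 < x0 by rewrite divr_gt0// ltr_wpDl.
have yx0 : y < x0 by rewrite (le_lt_trans my)// /x0; lra.
have x0l : x0 < l by rewrite /x0; lra.
have t0_gt0 : 0 < t0 by rewrite divr_gt0// subr_gt0.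
have labelE (z : R) : t0 - (z + v * t0) / v = - z / v by field.
have x0E : x0 = y + v * t0 by rewrite /t0 mulrC divfK// addrC subrK.
(* y lies on the characteristic through the interior point (t0, x0), where F   *)
(* is continuous without restriction. *)
have df : differentiable f (t0, x0).
  by apply: F_differentiable => //; rewrite ?x0_gt0// x0E labelE.
have shift (z : R) : 0 <= z + v * t0 <= l -> ~ N z -> F t0 (z + v * t0) = psi z.
  move=> z0l Nz; rewrite (psiE (ltW t0_gt0) z0l) ?addrK//.
  by rewrite labelE.
have cf : F t0 (z + v * t0) @[z --> y] --> F t0 x0.
  have /(_ y) cz : continuous (fun z => (t0, z + v * t0)).
    apply: continuous_pair; first exact: cst_continuous.
    by move=> z; apply: cvgD; [exact: cvg_id|exact: cvg_cst].
  have cfz := differentiable_continuous df; rewrite x0E in cfz.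
  by rewrite x0E; exact: (cvg_comp _ _ cz cfz).
rewrite -shift -?x0E ?(ltW x0_gt0) ?(ltW x0l)//.
apply: cvg_trans (cvg_within_filter _ cf); apply: near_eq_cvg.
have nz : \forall z \near y, 0 <= z + v * t0 <= l.
  have c0 : z + v * t0 @[z --> y] --> x0.
    by rewrite x0E; apply: cvgD; [exact: cvg_id|exact: cvg_cst].
  have H1 := cvgr_gt _ c0 _ x0_gt0; have H2 := cvgr_lt _ c0 _ x0l.
  near=> z; apply/andP; split; apply/ltW; near: z.
    exact: H1.
  exact: H2.
by rewrite near_withinE; apply: filterS nz => z z0l Nz; rewrite shift.
Unshelve. all: by end_near. Qed.

(** On the first two pieces of its definition [psi] is, off the countable set N, F composed with a
    continuous map into its domain of continuity; on the third it is 0. *)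
Let psi_measurable : measurable_fun setT psi.
Proof.
have D3 : setT = `]-oo, 0]%classic `|` (`]0, l]%classic `|` `]l, +oo[%classic) :> set R.
  apply/seteqP; split => // y _ /=; rewrite !in_itv/= andbT.
  by case: (leP y 0) => y0; [left|right; case: (leP y l) => yl; [left|right]].
rewrite D3; apply/measurable_funU => //; first exact: measurableU.
split; last apply/measurable_funU => //; last split.
- apply: (measurable_fun_countableD N_countable) => //.
  apply: subspace_continuous_measurable_fun.
    by apply: measurableD => //; exact: measurable_countable.
  apply: (@subspace_eq_continuous _ _ _ (f \o (fun y => (- y / v, 0)))).
    by move=> y /set_mem[/=]; rewrite in_itv/= => y0 _; rewrite /psi/= y0.
  apply: within_continuous_precomp F_continuous.
    move=> y [/=]; rewrite in_itv/= => y0 Ny; split => /=.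
    + by rewrite divr_ge0 ?oppr_ge0// ltW.
    + by rewrite lexx ltW.
    + by rewrite mul0r subr0.
  apply: continuous_pair; last exact: cst_continuous.
  by move=> y; apply: cvgMl; apply: cvgN; exact: cvg_id.
- apply: (measurable_fun_countableD N_countable) => //.
  apply: subspace_continuous_measurable_fun.
    by apply: measurableD => //; exact: measurable_countable.
  apply: (@subspace_eq_continuous _ _ _ (f \o (fun y => (0, y)))).
    move=> y /set_mem[/=]; rewrite in_itv/= => /andP[y0 yl] _.
    by rewrite /psi/= leNgt y0/= yl.
  apply: within_continuous_precomp F_continuous.
    move=> y [/=]; rewrite in_itv/= => /andP[y0 yl] Ny; split => //=.
    + by rewrite yl ltW.
    + by rewrite sub0r -mulNr.
  by apply: continuous_pair; [exact: cst_continuous|move=> y; exact: cvg_id].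
- apply: (eq_measurable_fun (cst (0:R))); last exact: measurable_cst.
  move=> y /set_mem/=; rewrite in_itv/= andbT => ly.
  by rewrite /psi !leNgt ly (lt_trans l_gt0 ly).
Qed.

Context (eta : R) (eta_gt0 : 0 < eta).

Let g (y : R) : R := expR (- eta * y) * psi y ^+ 2.

Local Notation energy := (energy eta l F).

Let expR_eta_measurable : measurable_fun setT (fun y : R => expR (- eta * y)).
Proof. by apply: measurableT_comp => //; exact: measurable_funM. Qed.

Let g_measurable : measurable_fun setT g.
Proof. by apply: measurable_funM => //; exact: measurable_funX. Qed.

Let g_integrable (a b : R) : lebesgue_measure.-integrable `[a, b] (EFin \o g).
Proof.
apply: measurable_bounded_integrable => //.
- by rewrite /= lebesgue_measure_itv/=; case: ifP => _; rewrite ?ltry// -EFinD ltry.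
- exact: measurable_funTS.
(* With T = - a / v the bound on [psi] holds exactly from a on. *)
have [M M0 psiM] := psi_bounded (- a / v).
exists (expR (- eta * a) * M ^+ 2); split; first exact: num_real.
move=> y My x /=; rewrite in_itv/= => /andP[ax xb]; apply: le_trans (ltW My).
rewrite normrM normrX ger0_norm ?expR_ge0// ler_pM ?expR_ge0//.
  by rewrite ler_expR ler_nM2l// oppr_lt0.
rewrite lerXn2r// ?nnegrE// psiM//.
by rewrite mulrC divfK// opprK.
Qed.

Let label_countable (t : R) : countable [set x | E (t - x / v)].
Proof.
apply: (@sub_countable _ _ _ ((fun y => y + v * t) @` N)).
  apply: subset_card_le => x Ex; exists (x - v * t); rewrite /= ?subrK//.
  by rewrite /N/= (_ : _ / v = t - x / v)//; field.
exact: card_le_trans (card_image_le _ _) N_countable.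
Qed.

Let flux_measurable (t : R) : 0 <= t -> measurable_fun `[0, l] (F t).
Proof.
move=> t0; apply: (measurable_fun_countableD (label_countable t)) => //.
apply: (eq_measurable_fun (fun x : R => psi (x - v * t))).
  by move=> x; rewrite inE/= in_itv/= => -[x0l nE]; rewrite psiE.
apply: measurable_funTS; apply: measurableT_comp => //.
exact: measurable_funB.
Qed.

Lemma energy_integrable (t : R) : 0 <= t ->
  lebesgue_measure.-integrable `[0, l]
    (EFin \o (fun x => expR (- eta * x) * F t x ^+ 2)).
Proof.
move=> t0; apply: measurable_bounded_integrable => //.
- by rewrite /= lebesgue_measure_itv/=; case: ifP => _; rewrite ?ltry// -EFinD ltry.
- apply: measurable_funM; first exact: measurable_funTS.
  by apply: measurable_funX; exact: flux_measurable.
have [M FM] := F_bounded t.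
exists (M ^+ 2); split; first exact: num_real.
move=> y My x /=; rewrite in_itv/= => /andP[x0 xl]; apply: le_trans (ltW My).
have {}FM : `|F t x| <= M by apply: FM; rewrite ?t0 ?lexx ?x0.
rewrite normrM normrX ger0_norm ?expR_ge0// -[leRHS]mul1r ler_pM ?expR_ge0//.
  by rewrite -expR0 ler_expR mulNr oppr_le0 mulr_ge0// ltW.
by rewrite lerXn2r// nnegrE (le_trans _ FM).
Qed.

Let primitive (a s : R) : R := \int[lebesgue_measure]_(y in `[a, s]) g y.

(** Substituting y = x - v t splits exp(- eta x) into exp(- eta v t) exp(- eta y) and makes the
    integrand independent of t. The base point - v T lies below all the endpoints with t <= T, so
    one primitive serves them all. *)
Let energyE (T t : R) : 0 <= t <= T -> energy t =
  expR (- (eta * v) * t) *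
  (primitive (- (v * T)) (l - v * t) - primitive (- (v * T)) (- (v * t))).
Proof.
move=> /andP[t0 tT].
rewrite /primitive Rintegral_itvB ?bnd_simp//; last 2 first.
- by rewrite lerN2 ler_pM2l.
- by rewrite lerDr ltW.
rewrite Rintegral_itv_obnd_cbnd; last first.
  apply: integrableS (g_integrable (- (v * t)) (l - v * t)) => //.
  by apply: subset_itvr; rewrite bnd_simp.
rewrite -[X in `[X, _]]add0r -Rintegral_translate//; last first.
  by move=> y; rewrite /g mulr_ge0 ?expR_ge0// sqr_ge0.
rewrite (@eq_Rintegral_countable _ [set x | E (t - x / v)] _
    (fun x => expR (eta * v * t) * (expR (- eta * x) * F t x ^+ 2))) //; first last.
- move=> x /=; rewrite in_itv/= => x0l nE; rewrite /g psiE// mulrA -expRD.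
  by congr (expR _ * _); ring.
- apply: measurable_funM => //; apply: measurable_funM; first exact: measurable_funTS.
  by apply: measurable_funX; exact: flux_measurable.
- by apply: measurable_funTS; apply: measurableT_comp => //; exact: measurable_funD.
rewrite RintegralZl//; last exact: energy_integrable.
by rewrite mulrA -expRD (_ : _ + _ = 0) ?expR0 ?mul1r//; ring.
Qed.

(** A primitive of an integrable function is continuous, so the energy does not jump even when an
    exceptional characteristic meets the boundary. *)
Lemma energy_continuous (T : R) : {within `[0, T], continuous energy}.
Proof.
pose P := primitive (- (v * T)).
apply: (@subspace_eq_continuous _ _ _
  (fun t => expR (- (eta * v) * t) * (P (l - v * t) - P (- (v * t))))).
  by move=> t /set_mem/=; rewrite in_itv/= => tT; exact/esym/energyE.
(* Applied with b = l and b = 0, for the two moving endpoints. *)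
have cP b : (forall t, 0 <= t <= T -> - (v * T) <= b - v * t <= l) ->
    {within `[0, T], continuous (fun t => P (b - v * t))}.
  have [T0 bT|T0 _] := leP 0 T; last first.
    by rewrite set_itv_ge ?bnd_simp -?ltNge//; exact: continuous_subspace0.
  have Tl : - (v * T) <= l.
    by move: l_gt0 (mulr_ge0 (ltW v_gt0) T0) => l0 vT; lra.
  apply: (@within_continuous_precomp _ _ _ _ `[- (v * T), l]%classic
    (fun t => b - v * t) P).
  - by move=> t /=; rewrite !in_itv/=; exact: bT.
  - move=> t; under eq_fun do rewrite -mulNr; exact: continuous_affine.
  - by apply: parameterized_integral_continuous => //; exact: g_integrable.
move=> t; apply: cvgM.
  apply: (@continuous_subspaceT _ _ _ (fun s => expR (- (eta * v) * s))) => s.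
  by apply: continuous_comp; [exact: mulrl_continuous|exact: continuous_expR].
apply: cvgB.
  apply: (cP l) => s /andP[s0 sT].
  have vs0 : 0 <= v * s by rewrite mulr_ge0// ltW.
  have vsT : v * s <= v * T by rewrite ler_pM2l.
  by move: l_gt0 vs0 vsT => l0 vs0 vsT; apply/andP; split; lra.
rewrite (_ : (fun x => P (- (v * x))) = (fun x => P (0 - v * x))); last first.
  by apply/funext => x; rewrite sub0r.
rewrite -[X in _ --> P X]sub0r; apply: (cP 0) => s /andP[s0 sT]; rewrite sub0r lerN2 ler_pM2l// sT/=.
by move: l_gt0 (mulr_ge0 (ltW v_gt0) s0) => l0 vs0; lra.
Qed.

(** Product rule in [energyE]: the endpoints move with speed - v, and the exponential factor turns
    the weights there into exp(- eta l) and 1. The conditions on E say that neither endpoint lies in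
    N. *)
Lemma is_derive_energy (t : R) : 0 < t -> ~ E t -> ~ E (t - l / v) ->
  is_derive t 1 energy
    (- (eta * v) * energy t + v * F t 0 ^+ 2 - v * expR (- eta * l) * F t l ^+ 2).
Proof.
(* Taking T beyond t puts - v T strictly below both endpoints and leaves room for times after t. *)
move=> t0 Et Etl; pose T := t + 1; pose P := primitive (- (v * T)).
have dP y : - (v * T) < y < l -> ~ N y -> is_derive y 1 P (g y).
  move=> /andP[Ty yl] Ny.
  apply: (@is_derive_Rintegral_countable _ _ N _ _ l) => //; first by rewrite Ty.
  apply: cvgM; last by apply: cvgM; exact: psi_cvg.
  apply: cvg_within_filter.
  by apply: continuous_comp; [exact: mulrl_continuous|exact: continuous_expR].
have vT : - (v * T) < - (v * t) by rewrite ltrN2 ltr_pM2l// ltrDl.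
have d1 : is_derive t 1 (P \o (fun s => l + - v * s)) (g (l + - v * t) * - v).
  apply: is_derive1_comp; last exact: is_derive_affine.
  apply: dP; last by rewrite /N/= (_ : _ / v = t - l / v)//; field.
  by rewrite mulNr gtrDl oppr_lt0 mulr_gt0// andbT ltr_wpDl// ltW.
have d0 : is_derive t 1 (P \o (fun s => 0 + - v * s)) (g (0 + - v * t) * - v).
  apply: is_derive1_comp; last exact: is_derive_affine.
  apply: dP; last by rewrite /N/= (_ : _ / v = t)//; field.
  by rewrite add0r mulNr vT (@lt_trans _ _ 0)// oppr_lt0 mulr_gt0.
have dW := is_deriveM (is_derive_expR_linear (- (eta * v)) t) (is_deriveB d1 d0).
have EW s : 0 <= s <= T -> expR (- (eta * v) * s) *
    ((P \o (fun s => l + - v * s)) s - (P \o (fun s => 0 + - v * s)) s) = energy s.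
  by move=> sT; rewrite (energyE sT) /= add0r [- v * s]mulNr.
have tT : 0 <= t <= T by rewrite (ltW t0) lerDl ler01.
have ft0 : F t 0 = psi (0 - v * t) by rewrite psiE ?lexx ?(ltW t0) ?(ltW l_gt0)// mul0r subr0.
have ftl : F t l = psi (l - v * t) by rewrite psiE ?lexx ?ltW.
apply: near_eq_is_derive (is_derive_eq dW _).
  near=> s; apply: EW; apply/andP; split; apply/ltW; near: s.
    exact: lt_nbhsr.
  by apply: lt_nbhsl; rewrite ltrDl.
have e1 : expR (- eta * l) = expR (- (eta * v) * t) * expR (- eta * (l + - v * t)).
  by rewrite -expRD; congr expR; ring.
have e0 : F t 0 ^+ 2 =
    expR (- (eta * v) * t) * expR (- eta * (0 + - v * t)) * psi (0 - v * t) ^+ 2.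
  rewrite -expRD (_ : - (eta * v) * t + _ = 0); last by ring.
  by rewrite expR0 mul1r ft0.
rewrite -(EW t tT) e1 e0 ftl /g /GRing.scale !fctE /= ![- v * t]mulNr.
by ring.
Unshelve. all: by end_near. Qed.

End characteristics.

(** * Quadratic forms with diagonal weights, and integrals of finite sums *)

Lemma diag_form (R : realType) (n : nat) (d x y : 'I_n -> R) :
  ((\col_e x e)^T *m diag_mx (\row_e d e) *m \col_e y e) 0 0 =
  \sum_e d e * x e * y e.
Proof.
rewrite mxE; apply: eq_bigr => e _.
by rewrite mul_mx_diag !mxE [d e * _]mulrC.
Qed.

Lemma diag_form2 (R : realType) (n : nat) (d d' x y : 'I_n -> R) :
  ((\col_e x e)^T *m diag_mx (\row_e d e) *m diag_mx (\row_e d' e) *m \col_e y e) 0 0 =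
  \sum_e d e * d' e * x e * y e.
Proof.
rewrite -[_ *m diag_mx _ *m diag_mx _]mulmxA mulmx_diag -diag_form.
by congr ((_ *m diag_mx _ *m _) 0 0); apply/rowP => e; rewrite !mxE.
Qed.

Lemma col_eta (R : realType) (n : nat) (x : 'cV[R]_n) : x = \col_e x e 0.
Proof. by apply/colP => e; rewrite mxE. Qed.

Lemma Rintegral_sum d (T : measurableType d) (R : realType)
    (mu : {measure set T -> \bar R}) (D : set T) (I : Type) (s : seq I)
    (f : I -> T -> R) : measurable D ->
  (forall i, mu.-integrable D (EFin \o f i)) ->
  \int[mu]_(x in D) (\sum_(i <- s) f i x) = \sum_(i <- s) \int[mu]_(x in D) f i x.
Proof.
move=> mD intf; rewrite /Rintegral.
under eq_integral do rewrite -sumEFin.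
rewrite integral_sum// (eq_bigr (fun i => (fine (\int[mu]_(x in D) (f i x)%:E))%:E)).
  by rewrite sumEFin.
by move=> i _; rewrite fineK//; apply: integrable_fin_num => //; exact: intf.
Qed.

(** * The Lyapunov function as a sum over processors, and its derivative *)

Section decay.
Context (R : realType) (n : nat) (l : R) (v mu : 'I_n.+1 -> R)
    (u : R -> R) (rho0 : R -> 'cV[R]_n.+1) (q0 : 'cV[R]_n.+1) (E : set R)
    (f : R -> R -> 'cV[R]_n.+1) (q : R -> 'cV[R]_n.+1)
    (eta etaq : R) (p c : 'I_n.+1 -> R).
Hypotheses (l_gt0 : 0 < l) (v_gt0 : forall e, 0 < v e)
    (E_countable : countable E)
    (fq_solution : is_solution l v mu u rho0 q0 E f q)
    (eta_gt0 : 0 < eta).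

Let F e (t x : R) : R := f t x e 0.
Let W e := energy eta l (F e).
Let D e (t : R) : R := c e * expR (- etaq * v e * t) * q t e 0 ^+ 2.

Let F_bounded e : forall T : R,
  exists M : R, forall t x : R, 0 <= t <= T -> 0 <= x <= l -> `|F e t x| <= M.
Proof.
by move=> T; have [M HM] := flux_locally_bounded fq_solution T; exists M => t x; exact: HM.
Qed.

Let F_continuous e :
  {within [set z : R * R | [/\ 0 <= z.1, 0 <= z.2 <= l & ~ E (z.1 - z.2 / v e)]],
    continuous (fun z : R * R => F e z.1 z.2)}.
Proof. exact: (flux_continuous fq_solution). Qed.

Let F_differentiable e (t x : R) : 0 < t -> 0 < x < l -> ~ E (t - x / v e) ->
  differentiable (fun z : R * R => F e z.1 z.2) (t, x).
Proof. exact: (flux_differentiable fq_solution). Qed.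

Let F_transport e (t x : R) : 0 < t -> 0 < x < l -> ~ E (t - x / v e) ->
  ((F e)^~ x)^`()%classic t + v e * (F e t)^`()%classic x = 0.
Proof. exact: (transport fq_solution). Qed.

Let W_integrable e := energy_integrable l_gt0 (v_gt0 e) E_countable
  (@F_continuous e) (@F_differentiable e) (@F_transport e) (@F_bounded e) eta_gt0.

Let W_continuous e (T : R) := @energy_continuous _ _ _ _ _ l_gt0 (v_gt0 e) E_countable
  (@F_continuous e) (@F_differentiable e) (@F_transport e) (@F_bounded e) eta eta_gt0 T.

Let W_derive e := is_derive_energy l_gt0 (v_gt0 e) E_countable
  (@F_continuous e) (@F_differentiable e) (@F_transport e) (@F_bounded e) eta_gt0.

Lemma lyapunovE (t : R) : 0 <= t ->
  lyapunov l v eta p etaq c f q t = \sum_e p e * W e t + \sum_e D e t.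
Proof.
move=> t0; rewrite /lyapunov; congr (_ + _); last first.
  by rewrite [q t]col_eta diag_form; apply: eq_bigr => e _; rewrite /D mulrA.
under eq_Rintegral => x _.
  rewrite [f t x]col_eta diag_form.
  under eq_bigr => e _ do rewrite -!mulrA -expr2.
  over.
rewrite Rintegral_sum//.
  by apply: eq_bigr => e _; rewrite RintegralZl//; exact: W_integrable.
move=> e; have intW := @W_integrable e t t0.
have mI : measurable (`[0, l]%classic : set (measurableTypeR R)) by [].
exact: (@integrableZl _ _ _ _ _ mI (p e) _ intW).
Qed.

Lemma boundary_formE (t : R) : derivable q t 1 ->
  boundary_form l v eta p etaq c f q t =
  \sum_e (- (v e * (p e * expR (- eta * l)) * F e t l ^+ 2) +
    v e * p e * F e t 0 ^+ 2 +
    2 * (c e * expR (- etaq * v e * t) * (fun s => q s e 0)^`()%classic t * q t e 0)).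
Proof.
move=> dq; rewrite /boundary_form.
have -> : q^`()%classic t = \col_e (fun s => q s e 0)^`()%classic t.
  by rewrite derive1E derive_mx//; apply/colP => e; rewrite !mxE derive1E.
rewrite [f t l]col_eta [f t 0]col_eta [q t]col_eta !diag_form2 diag_form.
rewrite mulr_sumr -sumrN -!big_split /=; apply: eq_bigr => e _.
by rewrite mulr0 expR0 /F mxE; ring.
Qed.

Lemma load_coord_continuous e : {within [set t | 0 <= t], continuous (fun t => q t e 0)}.
Proof.
apply: (@within_continuous_comp _ _ _ _ q (fun M : 'cV[R]_n.+1 => M e 0)).
  by move=> M _; exact: coord_continuous.
exact: load_continuous fq_solution.
Qed.

Lemma lyapunov_continuous (T : R) :
  {within `[0, T], continuous (lyapunov l v eta p etaq c f q)}.
Proof.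
apply: (@subspace_eq_continuous _ _ _ (fun t => \sum_e (p e * W e t + D e t))).
  move=> t /set_mem/=; rewrite in_itv/= => /andP[t0 _].
  by rewrite big_split /=; exact/esym/lyapunovE.
move=> t; apply: cvg_big => [|e _]; first exact: add_continuous.
 apply: cvgD.
  by apply: cvgMr; exact: W_continuous.
apply: cvgM.
  apply: cvgMr; apply: (@continuous_subspaceT _ _ _ (fun s => expR (- etaq * v e * s))) => s.
  by apply: continuous_comp; [exact: mulrl_continuous|exact: continuous_expR].
have cq := @continuous_subspaceW _ _ `[0, T]%classic _ _ _ (@load_coord_continuous e).
apply: cvgM; apply: cq => s /=; rewrite in_itv/= => /andP[]//.
Qed.

(** Differentiating the weights gives the subtracted damping sum; the endpoint terms of the fluxes
    and the derivative of the loads assemble into the boundary form. *)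
Lemma is_derive_lyapunov (t : R) : regular_time l v E t ->
  is_derive t 1 (lyapunov l v eta p etaq c f q)
    (boundary_form l v eta p etaq c f q t
     - \sum_e (eta * v e * (p e * W e t) + etaq * v e * D e t)).
Proof.
move=> rt; have [t0 nE] := rt.
have dq := load_derivable fq_solution rt.
have dqe e : is_derive t 1 (fun s => q s e 0) ((fun s => q s e 0)^`()%classic t).
  by rewrite derive1E; apply: derivableP; move/derivable_mxP : dq; exact.
pose h e := p e *: W e + c e *: ((fun s => expR (- etaq * v e * s)) * (fun s => q s e 0) ^+ 2).
have dh e := is_deriveD
  (@is_deriveZ _ _ _ _ (p e) _ _ _ (W_derive t0 (nE e).1 (nE e).2))
  (@is_deriveZ _ _ _ _ (c e) _ _ _
    (is_deriveM (is_derive_expR_linear (- etaq * v e) t) (is_deriveX 2 (dqe e)))).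
apply: near_eq_is_derive (is_derive_eq (is_derive_sum dh) _).
  near=> s; rewrite lyapunovE; last by apply/ltW; near: s; exact: lt_nbhsr.
  rewrite -big_split fct_sumE; apply: eq_bigr => e _.
  by rewrite /D !fctE /= /GRing.scale /= mulrA.
rewrite boundary_formE// -sumrB; apply: eq_bigr => e _.
by rewrite /D /GRing.scale /= !fctE -/(W e) /=; ring.
Unshelve. all: by end_near. Qed.

End decay.

(** * The decay rate and the exponential estimate *)

Lemma energy_ge0 (R : realType) (eta l : R) (F : R -> R -> R) (t : R) :
  0 <= energy eta l F t.
Proof.
by apply: Rintegral_ge0 => // x _; rewrite mulr_ge0 ?expR_ge0 ?sqr_ge0.
Qed.

Lemma decay_rate_gt0 (R : realType) (n : nat) (v : 'I_n.+1 -> R) (eta etaq : R) :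
  (forall e, 0 < v e) -> 0 < eta -> 0 < etaq -> 0 < decay_rate v eta etaq.
Proof.
move=> v0 eta0 etaq0; rewrite mulr_gt0 ?lt_min ?eta0//.
by apply: lt_bigmin => // e _; exact: v0.
Qed.

Lemma decay_rate_le (R : realType) (n : nat) (v : 'I_n.+1 -> R) (eta etaq : R) e :
  (forall e, 0 < v e) -> 0 < eta -> 0 < etaq ->
  decay_rate v eta etaq <= eta * v e /\ decay_rate v eta etaq <= etaq * v e.
Proof.
move=> v0 eta0 etaq0.
have m0 : 0 <= \big[Num.min/v ord0]_e v e by apply: le_bigmin => [|? _]; exact: ltW.
have mv : \big[Num.min/v ord0]_e v e <= v e by exact: bigmin_le.
have min0 : 0 <= Num.min eta etaq by rewrite le_min !ltW.
by split; rewrite ler_pM// ge_min lexx ?orbT.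
Qed.

(** For t > 0, lying outside this set is the same as being a regular time. *)
Lemma countable_nonregular (R : realType) (n : nat) (l : R) (v : 'I_n.+1 -> R) (E : set R) :
  countable E -> countable (E `|` \bigcup_e [set t | E (t - l / v e)]).
Proof.
move=> cE; rewrite -bigcup2E; apply: bigcup_countable => // -[|[|]]//= _.
apply: bigcup_countable => [|e _]; first exact: countableP.
apply: (@sub_countable _ _ _ ((fun y => y + l / v e) @` E)).
  by apply: subset_card_le => x Ex; exists (x - l / v e); rewrite ?subrK.
exact: card_le_trans (card_image_le _ _) cE.
Qed.

Theorem lemma3p1 (R : realType) (n : nat) (l : R) (v mu : 'I_n.+1 -> R)
    (u : R -> R) (rho0 : R -> 'cV[R]_n.+1) (q0 : 'cV[R]_n.+1) (E : set R)
    (f : R -> R -> 'cV[R]_n.+1) (q : R -> 'cV[R]_n.+1)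
    (eta etaq : R) (p c : 'I_n.+1 -> R)
    (l_gt0 : 0 < l) (v_gt0 : forall e, 0 < v e) (mu_gt0 : forall e, 0 < mu e)
    (E_countable : countable E)
    (fq_solution : is_solution l v mu u rho0 q0 E f q)
    (eta_gt0 : 0 < eta) (etaq_gt0 : 0 < etaq)
    (p_gt0 : forall e, 0 < p e) (c_gt0 : forall e, 0 < c e)
    (boundary_le0 : forall t, regular_time l v E t ->
       boundary_form l v eta p etaq c f q t <= 0) :
  let V := lyapunov l v eta p etaq c f q in
  let nu := decay_rate v eta etaq in
  [/\ 0 < nu,
      forall t, regular_time l v E t ->
        derivable V t 1 /\ V^`()%classic t <= - nu * V t
    & forall s t, 0 <= s -> s <= t -> V t <= expR (- nu * (t - s)) * V s].
Proof.
move=> V nu.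
have dV t : regular_time l v E t -> derivable V t 1 /\ V^`()%classic t <= - nu * V t.
  move=> rt; have [t0 _] := rt.
  have [D1 D2] := is_derive_lyapunov etaq p c l_gt0 v_gt0 E_countable fq_solution eta_gt0 rt.
  split; first exact: D1.
  rewrite derive1E D2 /V (lyapunovE _ _ _ l_gt0 v_gt0 E_countable fq_solution)//; last exact: ltW.
  (* The boundary form is dropped by hypothesis; the damping is then compared term by term, where
     nonnegativity of each energy allows its factor to be lowered to nu. *)
  rewrite mulNr -big_split /= mulr_sumr -[leRHS]add0r lerD ?boundary_le0// lerN2.
  apply: ler_sum => e _.
  have [nu_eta nu_etaq] := decay_rate_le e v_gt0 eta_gt0 etaq_gt0.
  rewrite mulrDr lerD// ler_wpM2r// mulr_ge0 ?sqr_ge0 ?energy_ge0// ?mulr_ge0 ?expR_ge0//.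
    exact: ltW.
  exact: ltW.
have nu_gt0 : 0 < nu by exact: decay_rate_gt0.
split=> // s t s0 st; pose C := E `|` \bigcup_e [set t | E (t - l / v e)].
have : expR (nu * t) * V t <= expR (nu * s) * V s.
  apply: (@le0_derive1_nincr_countable _ (fun r => expR (nu * r) * V r) C) => //.
  - exact: countable_nonregular.
  - have cV : {within `[s, t], continuous V}.
      have cV : {within `[0, t], continuous V}.
        exact: (@lyapunov_continuous _ _ _ _ _ _ _ _ _ _ _ _ etaq p c l_gt0 v_gt0
          E_countable fq_solution eta_gt0 t).
      apply: continuous_subspaceW cV.
      by move=> r /=; rewrite !in_itv/= => /andP[sr ->]; rewrite (le_trans s0 sr).
    move=> r; apply: cvgM; last exact: cV.
    apply: (@continuous_subspaceT _ _ _ (fun r => expR (nu * r))) => {}r.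
    by apply: continuous_comp; [exact: mulrl_continuous|exact: continuous_expR].
  (* Interior points satisfy r > s >= 0, so r is a regular time even when s = 0. There the
     derivative of exp(nu r) V(r) is exp(nu r) (V' + nu V) <= 0. *)
  move=> r /andP[sr rt] nCr.
  have [dVr V'r] : derivable V r 1 /\ V^`()%classic r <= - nu * V r.
    apply: dV; split=> [|e]; first exact: le_lt_trans sr.
    by split=> H; apply: nCr; [left|right; exists e].
  have dVr' : is_derive r 1 V (V^`()%classic r) by rewrite derive1E; exact: derivableP.
  have [D1 D2] := is_deriveM (is_derive_expR_linear nu r) dVr'.
  split; first exact: D1.
  rewrite derive1E D2 /GRing.scale /= 
    (_ : _ + _ = expR (nu * r) * (V^`()%classic r + nu * V r)); last by ring.
  by rewrite pmulr_rle0 ?expR_gt0// -lerBrDr sub0r -mulNr.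
rewrite mulrBr mulNr mulNr opprK expRD expRN => H.
by rewrite -mulrA ler_pdivlMl ?expR_gt0.
Qed.
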